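(* Uniform convergence in von Neumann's ergodic theorem on the whole space $\mathcal H$, i.e. $\|P_{t,s}-P\|_{\mathcal H\to\mathcal H}\to0$ as $t-s\to\infty$, takes place if and only if there exists $\gamma>0$ such that the set $(-\gamma,\gamma)\setminus\{0\}$ contains no points of the spectrum of the operator $\mathbf B$.
   Context: $\mathcal H$ is a complex Hilbert space and $\{U^t\}_{t\in\mathbb R}$ is a strongly continuous group of unitary operators on $\mathcal H$; by Stone's theorem $U^t=e^{it\mathbf B}$ for all $t\in\mathbb R$, with $\mathbf B$ self-adjoint (the infinitesimal generator). For $f\in\mathcal H$ and real $t>s$, $P_{t,s}f=\frac1{t-s}\int_s^tU^\tau f\,d\tau$, and $P$ is the orthogonal projection of $\mathcal H$ onto the subspace of vectors fixed by all $U^t$. *)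

(* Defs.v *)
From Stdlib Require Export Reals.
From Coquelicot Require Export Coquelicot.

Local Open Scope R_scope.

(** The inner product is linear in its first argument.  Positivity and
    definiteness follow from [inner_norm] and the norm axioms. *)
Record HilbertSpace := {
  hilbert_module :> CompleteNormedModule C_AbsRing;
  inner : hilbert_module -> hilbert_module -> C;
  inner_plus : forall x y z,
    inner (plus x y) z = Cplus (inner x z) (inner y z);
  inner_scal : forall (a : C) x y,
    inner (scal a x) y = Cmult a (inner x y);
  inner_conj : forall x y, inner y x = Cconj (inner x y);
  inner_norm : forall x, inner x x = RtoC (norm x ^ 2)
}.

Arguments inner {h} x y.

(** Restriction of scalars from C to R.  Coquelicot's [is_derive] and [RInt]
    for functions of a real variable take their values in modules over R; the
    carrier, addition, balls and norm below are those of [V] itself. *)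
Section RestrictScalars.

Variable V : CompleteNormedModule C_AbsRing.

Definition real_scal (r : R) (x : V) : V := scal (RtoC r : C_AbsRing) x.

Lemma real_scal_assoc (r s : R) (x : V) :
  real_scal r (real_scal s x) = real_scal (mult r s) x.
Proof.
  unfold real_scal. rewrite scal_assoc. f_equal.
  symmetry. exact (RtoC_mult r s).
Qed.

Lemma real_scal_one (x : V) : real_scal one x = x.
Proof. exact (scal_one x). Qed.

Lemma real_scal_distr_l (r : R) (x y : V) :
  real_scal r (plus x y) = plus (real_scal r x) (real_scal r y).
Proof. exact (scal_distr_l _ x y). Qed.

Lemma real_scal_distr_r (r s : R) (x : V) :
  real_scal (plus r s) x = plus (real_scal r x) (real_scal s x).
Proof.
  unfold real_scal.
  etransitivity; [| exact (scal_distr_r (RtoC r : C_AbsRing) (RtoC s) x)].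
  f_equal. exact (RtoC_plus r s).
Qed.

Lemma norm_real_scal (r : R) (x : V) :
  norm (real_scal r x) <= @abs R_AbsRing r * norm x.
Proof.
  unfold real_scal.
  eapply Rle_trans; [exact (@norm_scal C_AbsRing V (RtoC r : C_AbsRing) x) |].
  apply Req_le. f_equal. exact (Cmod_R r).
Qed.

Definition real_ModuleSpace_mixin :=
  ModuleSpace.Mixin R_Ring V real_scal
    real_scal_assoc real_scal_one real_scal_distr_l real_scal_distr_r.

Definition real_NormedModuleAux : NormedModuleAux R_AbsRing :=
  NormedModuleAux.Pack R_AbsRing V
    (NormedModuleAux.Class R_AbsRing V
       (ModuleSpace.Class R_Ring V (AbelianGroup.class V)
          real_ModuleSpace_mixin)
       (UniformSpace.class V)) V.

Definition real_NormedModule_mixin :=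
  NormedModule.Mixin R_AbsRing real_NormedModuleAux
    (@norm C_AbsRing V) (@norm_factor C_AbsRing V)
    norm_triangle norm_real_scal norm_compat1 norm_compat2 norm_eq_zero.

Definition real_module : CompleteNormedModule R_AbsRing :=
  CompleteNormedModule.Pack R_AbsRing V
    (CompleteNormedModule.Class R_AbsRing V
       (NormedModule.Class R_AbsRing V
          (NormedModuleAux.class R_AbsRing real_NormedModuleAux)
          real_NormedModule_mixin)
       (CompleteNormedModule.mixin _ _
          (CompleteNormedModule.class C_AbsRing V))) V.

End RestrictScalars.

Definition unitary {H : HilbertSpace} (A : H -> H) : Prop :=
  is_linear A /\
  (forall x y, inner (A x) (A y) = inner x y) /\
  (forall y, exists x, A x = y).

Record unitary_group {H : HilbertSpace} (U : R -> H -> H) : Prop := {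
  group_unitary : forall t, unitary (U t);
  group_zero : forall f, U 0 f = f;
  group_plus : forall s t f, U (s + t) f = U s (U t f);
  group_continuous : forall f t, continuous (fun tau => U tau f) t
}.

(** Unbounded operators are represented by their graphs: [B f g] means that
    [f] lies in the domain of [B] and that [B f = g]. *)
Definition graph (H : HilbertSpace) := H -> H -> Prop.

(** The operator [B] of Stone's theorem, [U t = exp (i t B)]: its domain
    consists of the [f] for which [t |-> U t f] is differentiable in norm at
    [0], and the derivative there is [i B f]. *)
Definition generator {H : HilbertSpace} (U : R -> H -> H) : graph H :=
  fun f g =>
    @is_derive R_AbsRing (real_module H) (fun t => U t f) 0 (scal Ci g).

(** [lambda] is in the resolvent set if [B - lambda] maps the domain of [B]
    bijectively onto [H] and its inverse [S] is bounded ([is_linear] includes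
    boundedness). *)
Definition resolvent_set {H : HilbertSpace} (B : graph H) (lambda : C) : Prop :=
  exists S : H -> H,
    is_linear S /\
    (forall y, exists g, B (S y) g /\ minus g (scal lambda (S y)) = y) /\
    (forall f g, B f g -> S (minus g (scal lambda f)) = f).

Definition spectrum {H : HilbertSpace} (B : graph H) (lambda : C) : Prop :=
  ~ resolvent_set B lambda.

(** The Riemann integral exists whenever [tau |-> U tau f] is continuous. *)
Definition ergodic_average {H : HilbertSpace} (U : R -> H -> H) (t s : R)
    (f : H) : H :=
  scal (RtoC (/ (t - s)))
       (@RInt (real_module H) (fun tau => U tau f) s t : H).

Definition fixed_space {H : HilbertSpace} (U : R -> H -> H) (f : H) : Prop :=
  forall t, U t f = f.

Definition orthogonal_projection {H : HilbertSpace} (M : H -> Prop)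
    (P : H -> H) : Prop :=
  forall f, M (P f) /\ (forall m, M m -> inner (minus f (P f)) m = 0%C).

(** The value is [p_infty] when [A] is unbounded. *)
Definition operator_norm {H : HilbertSpace} (A : H -> H) : Rbar :=
  Lub_Rbar (fun r => exists f : H, norm f <= 1 /\ r = norm (A f)).

Definition uniform_ergodic_convergence {H : HilbertSpace} (U : R -> H -> H)
    (P : H -> H) : Prop :=
  forall eps : R, 0 < eps ->
    exists T : R, forall t s : R, s < t -> T < t - s ->
      Rbar_lt
        (operator_norm (fun f => minus (ergodic_average U t s f) (P f))) eps.

(* Main.v *)
Require Import Defs.
From Stdlib Require Import Lra Lia Classical ClassicalEpsilon.
Local Open Scope R_scope.

(** Write [B] for the generator, [A] for the average over [[0, T]].

    Convergence implies a gap.  If [|A - P| <= 1/2] for one [T], put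
    [W f = int_0^T int_0^tau U^s f ds dtau].  Since [U^h] only moves the
    integration windows, [i B W = T (A - 1)] ([generator_double_integral]),
    hence [(B - lambda) (- i W / T) = 1 - D] with [D = A - (i lambda / T) W].
    For [|lambda| <= 1/(4T)] the operator [D] has norm at most 3/4 on the
    orthogonal complement of the fixed vectors, where a Neumann series
    therefore inverts [1 - D].  On the fixed vectors [B - lambda] is the
    multiplication by [- lambda].  So [lambda] is a regular value whenever it
    is nonzero.

    A gap implies convergence.  The operator [B^2] is symmetric, and every [t]
    in [(0, gamma^2)] is regular for it because
    [B^2 - t = (B - sqrt t) (B + sqrt t)].  For a
    symmetric operator [Q] the distance of a regular value [s] to the spectrum
    bounds [|(Q - s) f| / |f|] from below ([symmetric_gap]); at
    [s = gamma^2 / 2] this distance is at least [s] itself, and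
    [|B^2 f - s f| >= s |f|] expands to [|B^2 f| >= gamma |B f|]
    ([range_gap]).  Passing to the square is what makes the point [0], which may
    belong to the spectrum, an end point of the gap and not an interior point.
    This estimate shows that every [f] is the sum of [P f] and of a limit of
    vectors [B u] with [gamma |u| <= 2 |f|] ([kernel_approximation],
    [range_approximation]).  The average of [U^r B u] over [[s, t]] telescopes
    to [(U^t u - U^s u) / (i (t - s))], which gives
    [|P_(t,s) f - P f| <= 4 |f| / (gamma (t - s))] ([average_rate]). *)

(** * Vectors and the real inner product *)

(** The operations of a normed module can be reached through several
    convertible but syntactically different structures.  These constants fix
    one form, with vectors always typed in [H], so that rewriting applies. *)
Definition vadd {H : HilbertSpace} (x y : H) : H := plus x y.
Definition vsub {H : HilbertSpace} (x y : H) : H := minus x y.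
Definition vscal {H : HilbertSpace} (a : C) (x : H) : H := scal a x.
Definition vzero {H : HilbertSpace} : H := zero.

Local Notation "x +: y" := (vadd x y) (at level 50, left associativity).
Local Notation "x -: y" := (vsub x y) (at level 50, left associativity).
Local Notation "a *: x" := (vscal a x) (at level 40, left associativity).

Section Geometry.

Context {H : HilbertSpace}.
Implicit Types x y z : H.

Lemma inner_vadd x y z : inner (x +: y) z = Cplus (inner x z) (inner y z).
Proof. exact (inner_plus H x y z). Qed.

Lemma inner_vscal (a : C) x y : inner (a *: x) y = Cmult a (inner x y).
Proof. exact (inner_scal H a x y). Qed.

Lemma inner_vzero y : inner vzero y = 0%C.
Proof.
  assert (E : vzero = 0%C *: y) by (symmetry; exact (@scal_zero_l C_AbsRing H y)).
  rewrite E, inner_vscal. ring.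
Qed.

Lemma vsub_eq x y : x -: y = x +: Copp 1 *: y.
Proof.
  unfold vsub, minus, vadd. f_equal. symmetry.
  exact (@scal_opp_one C_AbsRing H y).
Qed.

Lemma inner_vsub x y z : inner (x -: y) z = Cminus (inner x z) (inner y z).
Proof. rewrite vsub_eq, inner_vadd, inner_vscal. ring. Qed.

Lemma norm_vzero : norm (@vzero H) = 0.
Proof. exact (@norm_zero C_AbsRing H). Qed.

Lemma norm_eq_vzero x : norm x = 0 -> x = vzero.
Proof. exact (@norm_eq_zero C_AbsRing H x). Qed.

Lemma vsub_eq_zero x y : x -: y = vzero -> x = y.
Proof.
  intro E. apply (@plus_reg_r H (opp y)). rewrite plus_opp_r. exact E.
Qed.

Lemma inner_ext x y : (forall z, inner x z = inner y z) -> x = y.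
Proof.
  intro E. apply vsub_eq_zero, norm_eq_vzero.
  assert (Q := inner_norm H (x -: y)).
  rewrite inner_vsub, E in Q.
  apply (f_equal fst) in Q. simpl in Q. nra.
Qed.

Definition rdot x y : R := fst (inner x y).

Lemma rdot_sym x y : rdot x y = rdot y x.
Proof. unfold rdot. rewrite (inner_conj H x y). reflexivity. Qed.

Lemma rdot_vadd_l x y z : rdot (x +: y) z = rdot x z + rdot y z.
Proof. unfold rdot. rewrite inner_vadd. reflexivity. Qed.

Lemma rdot_vscal_l (r : R) x z : rdot (r *: x) z = r * rdot x z.
Proof. unfold rdot. rewrite inner_vscal. simpl. ring. Qed.

Lemma rdot_vsub_l x y z : rdot (x -: y) z = rdot x z - rdot y z.
Proof. unfold rdot. rewrite inner_vsub. reflexivity. Qed.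

Lemma rdot_vadd_r x y z : rdot z (x +: y) = rdot z x + rdot z y.
Proof. rewrite rdot_sym, rdot_vadd_l, !(rdot_sym _ z). reflexivity. Qed.

Lemma rdot_vsub_r x y z : rdot z (x -: y) = rdot z x - rdot z y.
Proof. rewrite rdot_sym, rdot_vsub_l, !(rdot_sym _ z). reflexivity. Qed.

Lemma rdot_vscal_r (r : R) x z : rdot z (r *: x) = r * rdot z x.
Proof. rewrite rdot_sym, rdot_vscal_l, (rdot_sym z). reflexivity. Qed.

Lemma rdot_Ci x y : rdot (Ci *: x) (Ci *: y) = rdot x y.
Proof.
  unfold rdot. rewrite inner_vscal, inner_conj, inner_vscal, (inner_conj H x y).
  simpl. ring.
Qed.

Lemma norm_sq x : norm x ^ 2 = rdot x x.
Proof. unfold rdot. rewrite inner_norm. reflexivity. Qed.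

Lemma norm_vadd_le x y : norm (x +: y) <= norm x + norm y.
Proof. exact (@norm_triangle C_AbsRing H x y). Qed.

Lemma norm_vscal (a : C) x : norm (a *: x) = Cmod a * norm x.
Proof.
  assert (E : norm (a *: x) ^ 2 = (Cmod a * norm x) ^ 2).
  { rewrite Rpow_mult_distr, !norm_sq. unfold rdot.
    rewrite inner_vscal, inner_conj, inner_vscal, inner_norm.
    unfold Cmod. rewrite pow2_sqrt by nra. simpl. ring. }
  apply Rsqr_inj.
  - apply norm_ge_0.
  - apply Rmult_le_pos; [apply Cmod_ge_0 | apply norm_ge_0].
  - rewrite !Rsqr_pow2. exact E.
Qed.

Lemma norm_vscalR (r : R) x : norm (r *: x) = Rabs r * norm x.
Proof. rewrite norm_vscal, Cmod_R. reflexivity. Qed.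

Lemma norm_vsub_le x y : norm (x -: y) <= norm x + norm y.
Proof.
  rewrite vsub_eq. apply Rle_trans with (1 := norm_vadd_le _ _).
  rewrite norm_vscal, Cmod_opp, Cmod_1. lra.
Qed.

(** The Cauchy-Schwarz inequality, from [||y| x + |x| y|^2 >= 0] and the same with
    a minus sign. *)
Lemma rdot_bound x y : Rabs (rdot x y) <= norm x * norm y.
Proof.
  assert (Ka := norm_ge_0 x). assert (Kb := norm_ge_0 y).
  assert (Ex := norm_sq x). assert (Ey := norm_sq y).
  assert (P1 := norm_sq (norm y *: x +: norm x *: y)).
  assert (P2 := norm_sq (norm y *: x -: norm x *: y)).
  assert (Q1 := pow2_ge_0 (norm (norm y *: x +: norm x *: y))).
  assert (Q2 := pow2_ge_0 (norm (norm y *: x -: norm x *: y))).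
  rewrite P1 in Q1. rewrite P2 in Q2. clear P1 P2.
  rewrite ?rdot_vadd_l, ?rdot_vsub_l, ?rdot_vscal_l,
    ?rdot_vadd_r, ?rdot_vsub_r, ?rdot_vscal_r
    in Q1.
  rewrite ?rdot_vadd_l, ?rdot_vsub_l, ?rdot_vscal_l,
    ?rdot_vadd_r, ?rdot_vsub_r, ?rdot_vscal_r in Q2.
  rewrite (rdot_sym y x), <- Ex, <- Ey in Q1, Q2.
  destruct (Rle_lt_dec (norm x * norm y) 0) as [Z | Z].
  - assert (D : norm x = 0 \/ norm y = 0)
      by (apply Rmult_integral; apply Rle_antisym; [assumption | nra]).
    assert (W : rdot x y = 0).
    { destruct D as [D | D]; apply norm_eq_vzero in D; rewrite D;
        [| rewrite rdot_sym]; unfold rdot; rewrite inner_vzero; reflexivity. }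
    rewrite W, Rabs_R0. nra.
  - apply Rabs_le. split; apply (Rmult_le_reg_l (norm x * norm y)); nra.
Qed.

End Geometry.

(** Two vectors agree if their inner products with every vector do, which
    turns identities between vectors into identities of complex numbers. *)
Ltac hilbert_ring :=
  apply inner_ext; intro;
  repeat progress rewrite ?inner_vsub, ?inner_vadd, ?inner_vzero, ?inner_vscal;
  rewrite ?RtoC_plus, ?RtoC_minus, ?RtoC_mult, ?RtoC_opp;
  try ring.

(** * Completeness *)

Lemma cauchy_limit {H : HilbertSpace} (x : nat -> H) :
  (forall eps, 0 < eps -> exists N, forall n m,
     (N <= n)%nat -> (N <= m)%nat -> norm (x n -: x m) < eps) ->
  exists l, forall eps, 0 < eps -> exists N, forall n,
     (N <= n)%nat -> norm (x n -: l) < eps.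
Proof.
  intro Cx.
  destruct (proj1 (@filterlim_locally_cauchy nat (hilbert_module H) eventually _ x))
    as [l Hl].
  { intros [eps eps_pos]. destruct (Cx eps eps_pos) as [N HN].
    exists (fun n => (N <= n)%nat). split; [exists N; auto |].
    intros n m Hn Hm. apply (@norm_compat1 C_AbsRing H). exact (HN m n Hm Hn). }
  exists l. intros eps eps_pos.
  assert (Fp := @norm_factor_gt_0 C_AbsRing H).
  assert (ep : 0 < eps / @norm_factor C_AbsRing H)
    by (apply Rdiv_lt_0_compat; assumption).
  destruct (proj1 (filterlim_locally x l) Hl (mkposreal _ ep)) as [N HN].
  exists N. intros n Hn.
  assert (B := @norm_compat2 C_AbsRing H _ _ _ (HN n Hn)). simpl in B.
  replace (norm_factor * (eps / norm_factor)) with eps in B by (field; lra).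
  exact B.
Qed.

(** The Neumann series, summed as the limit of [x_(n+1) = y + D x_n]. *)
Lemma neumann {H : HilbertSpace} (D : H -> H) (q : R) :
  0 <= q < 1 ->
  (forall x y, D x -: D y = D (x -: y)) -> (forall x, norm (D x) <= q * norm x) ->
  forall y, exists z, z -: D z = y.
Proof.
  intros Hq Dsub Dq y.
  set (x := fix x n := match n with O => vzero | S n => y +: D (x n) end).
  set (M := norm y / (1 - q)).
  assert (M0 : 0 <= M) by (apply Rle_mult_inv_pos; [apply norm_ge_0 | lra]).
  assert (xM : forall n, norm (x n) <= M).
  { induction n as [| n IH]; simpl.
    - rewrite norm_vzero. exact M0.
    - apply Rle_trans with (1 := norm_vadd_le _ _).
      assert (norm y = (1 - q) * M) by (unfold M; field; lra).
      assert (A := Dq (x n)). assert (q * norm (x n) <= q * M)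
        by (apply Rmult_le_compat_l; [lra | exact IH]). lra. }
  assert (xq : forall n k, norm (x (n + k)%nat -: x n) <= q ^ n * M).
  { induction n as [| n IH]; intro k.
    - simpl. replace (x k -: vzero) with (x k) by hilbert_ring.
      rewrite Rmult_1_l. apply xM.
    - simpl. replace (y +: D (x (n + k)%nat) -: (y +: D (x n)))
        with (D (x (n + k)%nat) -: D (x n)) by hilbert_ring.
      rewrite Dsub, Rmult_assoc. apply Rle_trans with (1 := Dq _).
      apply Rmult_le_compat_l; [lra | apply IH]. }
  assert (small : forall eps, 0 < eps -> exists N, forall n, (N <= n)%nat ->
            q ^ n * M < eps).
  { intros eps ep.
    destruct (pow_lt_1_zero q) with (y := eps / (M + 1)) as [N HN].
    - rewrite Rabs_pos_eq; lra.
    - apply Rdiv_lt_0_compat; lra.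
    - exists N. intros n Hn. assert (A := HN n Hn).
      assert (B := pow_le q n (proj1 Hq)).
      rewrite Rabs_pos_eq in A by exact B.
      apply Rle_lt_trans with (q ^ n * (M + 1)); [nra |].
      replace eps with (eps / (M + 1) * (M + 1)) at 1 by (field; lra).
      apply Rmult_lt_compat_r; lra. }
  destruct (cauchy_limit x) as [z Hz].
  { intros eps ep. destruct (small (eps / 2)) as [N HN]; [lra |].
    exists N. intros n m Hn Hm.
    replace (x n -: x m) with ((x n -: x N) -: (x m -: x N)) by hilbert_ring.
    apply Rle_lt_trans with (1 := norm_vsub_le _ _).
    assert (A := HN N (le_n N)).
    assert (B1 := xq N (n - N)%nat). assert (B2 := xq N (m - N)%nat).
    replace (N + (n - N))%nat with n in B1 by lia.
    replace (N + (m - N))%nat with m in B2 by lia. lra. }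
  exists z. apply vsub_eq_zero, norm_eq_vzero, Rle_antisym; [| apply norm_ge_0].
  apply Rnot_lt_le. intro P.
  destruct (Hz (norm (z -: D z -: y) / 2)) as [N HN]; [lra |].
  assert (A1 := HN N (le_n N)). assert (A2 := HN (S N) (le_S _ _ (le_n N))).
  assert (T : norm (z -: D z -: y) <= norm (D (x N -: z)) + norm (x (S N) -: z)).
  { rewrite <- Dsub.
    replace (z -: D z -: y) with ((D (x N) -: D z) -: (x (S N) -: z))
      by (simpl; hilbert_ring).
    apply norm_vsub_le. }
  assert (A3 := Dq (x N -: z)). assert (A4 := norm_ge_0 (x N -: z)). nra.
Qed.

(** * Gaps in the spectrum of a symmetric operator *)

Definition linear_graph {H : HilbertSpace} (B : graph H) : Prop :=
  forall f g f' g' (a : C), B f g -> B f' g' -> B (f +: a *: f') (g +: a *: g').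

Definition symmetric_graph {H : HilbertSpace} (B : graph H) : Prop :=
  forall f g f' g', B f g -> B f' g' -> rdot g f' = rdot f g'.

Definition bounded_below {H : HilbertSpace} (B : graph H) (t : R) : Prop :=
  exists K, 0 < K /\ forall f g, B f g -> norm f <= K * norm (g -: t *: f).

Definition onto {H : HilbertSpace} (B : graph H) (t : R) : Prop :=
  forall x, exists f g, B f g /\ g -: t *: f = x.

Section SymmetricGap.

Context {H : HilbertSpace} (Q : graph H) (s : R).
Hypothesis Q_linear : linear_graph Q.
Hypothesis Q_symmetric : symmetric_graph Q.
Hypothesis Q_onto : onto Q s.
Hypothesis Q_below : forall t, 0 < t < 2 * s -> bounded_below Q t.

Definition lower_bound (m : R) : Prop :=
  forall f g, Q f g -> m * norm f <= norm (g -: s *: f).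

(** With [x = (Q - s) h] and [h = (Q - s) k], symmetry and [m |k| <= |h|] give
    [|x - m^2 k|^2 <= |x|^2 - m^2 |h|^2], while
    [x - m^2 k = (Q - s - m) (Q - s + m) k] has norm at least a fixed multiple
    of [|x|].  The difference leaves room to enlarge [m]. *)
Lemma lower_bound_improves (m : R) :
  0 < m < s -> lower_bound m -> exists m', m < m' /\ lower_bound m'.
Proof.
  intros Hm E.
  destruct (Q_below (s + m)) as [K1 [K1p B1]]; [lra |].
  destruct (Q_below (s - m)) as [K2 [K2p B2]]; [lra |].
  set (L := 1 + m ^ 2 * (K2 * K1)).
  assert (Lp : 1 < L).
  { assert (0 < m ^ 2 * (K2 * K1)); [| unfold L; lra].
    apply Rmult_lt_0_compat; [nra | apply Rmult_lt_0_compat; assumption]. }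
  set (r := sqrt (L ^ 2 - 1)).
  assert (rp : 0 < r) by (apply sqrt_lt_R0; nra).
  assert (r2 : r ^ 2 = L ^ 2 - 1) by (apply pow2_sqrt; nra).
  assert (rL : r < L) by nra.
  (* From [|x| <= L |x - m^2 k|] one gets [L^2 m^2 |h|^2 <= (L^2 - 1) |x|^2],
     so that [m] improves by the factor [L / sqrt (L^2 - 1)]. *)
  exists (m * L / r). split.
  { apply (Rmult_lt_reg_r r); [assumption |].
    replace (m * L / r * r) with (m * L) by (field; lra). nra. }
  intros h g Qhg. remember (g -: s *: h) as x eqn:Dx.
  destruct (Q_onto h) as [k [l [Qkl Eh]]].
  assert (Ek := E k l Qkl). rewrite Eh in Ek.
  assert (Sy := Q_symmetric k l h g Qkl Qhg).
  assert (Skx : rdot k x = rdot h h).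
  { transitivity (rdot (l -: s *: k) h); [| rewrite Eh; reflexivity].
    rewrite Dx, rdot_vsub_r, rdot_vscal_r, rdot_vsub_l, rdot_vscal_l, Sy.
    reflexivity. }
  assert (N1 : norm (x -: (m * m)%R *: k) ^ 2 <= norm x ^ 2 - m ^ 2 * norm h ^ 2).
  { rewrite !norm_sq.
    rewrite ?rdot_vsub_l, ?rdot_vscal_l, ?rdot_vsub_r, ?rdot_vscal_r.
    rewrite (rdot_sym x k), Skx, <- !norm_sq.
    assert (K0 := norm_ge_0 k). assert (m * norm k * (m * norm k) <= norm h * norm h).
    { apply Rmult_le_compat; nra. }
    assert (0 <= m ^ 2) by nra. nra. }
  assert (W : Q (h +: m *: k) (g +: m *: l)) by (apply Q_linear; assumption).
  assert (N2 := B1 _ _ W). assert (N3 := B2 _ _ Qkl).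
  replace (g +: m *: l -: (s + m)%R *: (h +: m *: k)) with (x -: (m * m)%R *: k) in N2.
  2:{ rewrite Dx, <- Eh. hilbert_ring. }
  replace (l -: (s - m)%R *: k) with (h +: m *: k) in N3.
  2:{ rewrite <- Eh. hilbert_ring. }
  set (v := norm (x -: (m * m)%R *: k)) in *.
  assert (v0 : 0 <= v) by apply norm_ge_0.
  assert (Nk : norm k <= K2 * K1 * v).
  { rewrite Rmult_assoc. apply Rle_trans with (1 := N3).
    apply Rmult_le_compat_l; lra. }
  assert (Nx : norm x <= L * v).
  { replace x with ((x -: (m * m)%R *: k) +: (m * m)%R *: k) at 1 by hilbert_ring.
    apply Rle_trans with (1 := norm_vadd_le _ _).
    rewrite norm_vscalR, Rabs_pos_eq by nra. fold v. unfold L.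
    assert (0 <= m ^ 2) by nra. nra. }
  assert (h0 := norm_ge_0 h). assert (x0 := norm_ge_0 x).
  assert (N4 : (m * L * norm h) ^ 2 <= (r * norm x) ^ 2).
  { assert (norm x ^ 2 <= L ^ 2 * v ^ 2).
    { replace (L ^ 2 * v ^ 2) with ((L * v) ^ 2) by ring. apply pow_incr. lra. }
    assert (L ^ 2 * v ^ 2 <= L ^ 2 * (norm x ^ 2 - m ^ 2 * norm h ^ 2)).
    { apply Rmult_le_compat_l; [nra | assumption]. }
    rewrite !Rpow_mult_distr, r2. nra. }
  assert (N5 : m * L * norm h <= r * norm x).
  { apply Rsqr_incr_0_var; [rewrite !Rsqr_pow2; exact N4 | nra]. }
  apply (Rmult_le_reg_l r); [assumption |].
  replace (r * (m * L / r * norm h)) with (m * L * norm h) by (field; lra).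
  exact N5.
Qed.

(** The supremum of the admissible bounds below [s] is admissible, hence by
    [lower_bound_improves] it cannot be smaller than [s]. *)
Lemma symmetric_gap : 0 < s -> lower_bound s.
Proof.
  intro sp.
  destruct (Q_below s) as [K [Kp BK]]; [lra |].
  set (m0 := Rmin s (/ K)).
  assert (m0p : 0 < m0) by (apply Rmin_glb_lt; [| apply Rinv_0_lt_compat]; lra).
  assert (weaken : forall m m', m <= m' -> lower_bound m' -> lower_bound m).
  { intros m m' Hm E f g Qfg. apply Rle_trans with (2 := E f g Qfg).
    apply Rmult_le_compat_r; [apply norm_ge_0 | exact Hm]. }
  assert (E0 : lower_bound m0).
  { apply (weaken _ (/ K)); [apply Rmin_r |].
    intros f g Qfg. apply (Rmult_le_reg_l K); [assumption |].
    rewrite <- Rmult_assoc, Rinv_r, Rmult_1_l by lra. exact (BK f g Qfg). }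
  destruct (completeness (fun m => m <= s /\ lower_bound m)) as [M [U1 U2]].
  { exists s. intros m [Hm _]. exact Hm. }
  { exists m0. split; [apply Rmin_l | exact E0]. }
  assert (M0 : m0 <= M) by (apply U1; split; [apply Rmin_l | exact E0]).
  assert (Ms : M <= s) by (apply U2; intros m [Hm _]; exact Hm).
  assert (EM : lower_bound M).
  { intros f g Qfg. destruct (Rle_lt_or_eq_dec _ _ (norm_ge_0 f)) as [f0 | f0].
    - apply (Rmult_le_reg_r (/ norm f)); [apply Rinv_0_lt_compat; assumption |].
      rewrite Rmult_assoc, Rinv_r, Rmult_1_r by lra.
      apply U2. intros m [_ Em]. apply (Rmult_le_reg_r (norm f)); [assumption |].
      rewrite Rmult_assoc, Rinv_l, Rmult_1_r by lra. exact (Em f g Qfg).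
    - rewrite <- f0, Rmult_0_r. apply norm_ge_0. }
  destruct (Rle_lt_or_eq_dec _ _ Ms) as [Lt | <-]; [| exact EM].
  destruct (lower_bound_improves M) as [m' [Lm' Em']]; [lra | exact EM |].
  assert (A : Rmin m' s <= M).
  { apply U1. split; [apply Rmin_r | apply (weaken _ m'); [apply Rmin_l | exact Em']]. }
  unfold Rmin in A. destruct (Rle_dec m' s); lra.
Qed.

End SymmetricGap.

(** * An isolated point of the spectrum at zero *)

Definition square {H : HilbertSpace} (B : graph H) : graph H :=
  fun f h => exists g, B f g /\ B g h.

Section IsolatedZero.

Context {H : HilbertSpace} (B : graph H) (gamma : R).
Hypothesis B_linear : linear_graph B.
Hypothesis B_symmetric : symmetric_graph B.
Hypothesis gamma_pos : 0 < gamma.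
Hypothesis B_resolvent : forall lambda : R,
  - gamma < lambda < gamma -> lambda <> 0 -> resolvent_set B lambda.

Lemma linear_graph_sub f g f' g' :
  B f g -> B f' g' -> B (f -: f') (g -: g').
Proof.
  intros E E'. rewrite !vsub_eq. apply B_linear; assumption.
Qed.

Lemma resolvent_bounded_below (lambda : R) :
  resolvent_set B lambda -> bounded_below B lambda.
Proof.
  intros [S [[_ _ [K [Kp HK]]] [_ Sl]]]. exists K. split; [exact Kp |].
  intros f g Bfg. rewrite <- (Sl f g Bfg) at 1. exact (HK _).
Qed.

Lemma resolvent_onto (lambda : R) : resolvent_set B lambda -> onto B lambda.
Proof.
  intros [S [_ [Sr _]]] y. destruct (Sr y) as [g [Bg E]].
  exists (S y), g. split; [exact Bg | exact E].
Qed.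

(** [B^2 - t = (B - r) (B + r)] for [r = sqrt t]. *)
Lemma square_factors (t : R) : 0 < t < gamma ^ 2 ->
  bounded_below (square B) t /\ onto (square B) t.
Proof.
  intros [t0 tg]. set (r := sqrt t).
  assert (r0 : 0 < r) by (apply sqrt_lt_R0; exact t0).
  assert (rr : t = r * r) by (symmetry; apply sqrt_sqrt; lra).
  assert (rg : r < gamma) by nra.
  assert (R1 : resolvent_set B r) by (apply B_resolvent; lra).
  assert (R2 : resolvent_set B (- r)%R) by (apply B_resolvent; lra).
  split.
  - destruct (resolvent_bounded_below _ R1) as [K1 [K1p H1]].
    destruct (resolvent_bounded_below _ R2) as [K2 [K2p H2]].
    exists (K1 * K2). split; [apply Rmult_lt_0_compat; assumption |].
    intros f h [g [Bfg Bgh]].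
    apply Rle_trans with (1 := H1 f g Bfg). rewrite Rmult_assoc.
    apply Rmult_le_compat_l; [lra |].
    replace (h -: t *: f) with ((h -: r *: g) -: (- r)%R *: (g -: r *: f))
      by (rewrite rr; hilbert_ring).
    apply H2.
    replace (g -: r *: f) with (g +: Copp r *: f) by hilbert_ring.
    replace (h -: r *: g) with (h +: Copp r *: g) by hilbert_ring.
    apply B_linear; assumption.
  - intro x.
    destruct (resolvent_onto _ R2 x) as [u [v [Buv E]]].
    destruct (resolvent_onto _ R1 u) as [f [g [Bfg E']]].
    exists f, (v +: r *: g). split.
    + exists g. split; [exact Bfg |].
      replace g with (u +: r *: f) at 1 by (rewrite <- E'; hilbert_ring).
      apply B_linear; assumption.
    + rewrite <- E, <- E', rr. hilbert_ring.
Qed.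

Lemma square_gap (t : R) : 0 < t <= gamma ^ 2 / 2 ->
  lower_bound (square B) t t.
Proof.
  intros [t0 tg]. apply symmetric_gap; [| | | | exact t0].
  - intros f g f' g' a [u [Bu Bg]] [u' [Bu' Bg']].
    exists (u +: a *: u'). split; apply B_linear; assumption.
  - intros f g f' g' [u [Bu Bg]] [u' [Bu' Bg']].
    rewrite (B_symmetric _ _ _ _ Bg Bu'). exact (B_symmetric _ _ _ _ Bu Bg').
  - apply square_factors. nra.
  - intros r Hr. apply square_factors. lra.
Qed.

(** [|B^2 f - s f| >= s |f|] for [s = gamma^2 / 2] expands to
    [|B^2 f|^2 >= gamma^2 (B^2 f, f) = gamma^2 |B f|^2]. *)
Lemma range_gap f g h : B f g -> B g h -> gamma * norm g <= norm h.
Proof.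
  intros Bfg Bgh.
  set (s := gamma ^ 2 / 2). assert (s0 : 0 < s) by (unfold s; nra).
  assert (E : s * norm f <= norm (h -: s *: f)).
  { apply square_gap; [split; [exact s0 | apply Rle_refl] | exists g; split; assumption]. }
  assert (E2 : (s * norm f) ^ 2 <= norm (h -: s *: f) ^ 2).
  { apply pow_incr. split; [| exact E].
    apply Rmult_le_pos; [lra | apply norm_ge_0]. }
  rewrite Rpow_mult_distr, !norm_sq in E2.
  rewrite ?rdot_vsub_l, ?rdot_vscal_l, ?rdot_vsub_r, ?rdot_vscal_r in E2.
  assert (Sy := B_symmetric _ _ _ _ Bgh Bfg).
  rewrite (rdot_sym f h), Sy, <- !norm_sq in E2.
  apply Rsqr_incr_0_var; [| apply norm_ge_0].
  rewrite !Rsqr_pow2, Rpow_mult_distr.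
  replace (gamma ^ 2) with (2 * s) by (unfold s; lra). nra.
Qed.

(** The part [q = - s h] of [f = B^2 h - s h] outside the range of [B^2]
    converges as [s] tends to [0]: differences of such parts lie in the range
    of [B], where [range_gap] bounds them by their images under [B], and these
    images [- s B h] tend to [0]. *)
Lemma kernel_approximation (f : H) :
  exists p, forall eps, 0 < eps -> exists u w q v,
    B u w /\ f = w +: q /\ gamma * norm u <= 2 * norm f /\
    norm (q -: p) < eps /\ B q v /\ norm v < eps.
Proof.
  (* At step [n], [B^2 h - s h = f] is solved with [u = B h], [w = B u]. *)
  set (s := fun n => gamma ^ 2 / 2 * / INR (S n)).
  assert (g2 : 0 < gamma ^ 2 / 2) by nra.
  assert (s0 : forall n, 0 < s n).
  { intro n. apply Rmult_lt_0_compat; [lra |].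
    apply Rinv_0_lt_compat, lt_0_INR. lia. }
  assert (s1 : forall n, s n <= gamma ^ 2 / 2).
  { intro n. apply Rle_trans with (gamma ^ 2 / 2 * 1); [| lra].
    apply Rmult_le_compat_l; [lra |]. rewrite <- Rinv_1.
    apply Rinv_le_contravar; [lra |]. rewrite S_INR. assert (I := pos_INR n). lra. }
  assert (sl : forall eps, 0 < eps -> exists N, forall n, (N <= n)%nat -> s n < eps).
  { intros eps ep. destruct (archimed_cor1 (eps / (gamma ^ 2 / 2))) as [N [HN Np]].
    { apply Rdiv_lt_0_compat; lra. }
    exists N. intros n Hn. unfold s.
    replace eps with (gamma ^ 2 / 2 * (eps / (gamma ^ 2 / 2))) by (field; lra).
    apply Rmult_lt_compat_l; [lra |]. apply Rle_lt_trans with (2 := HN).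
    apply Rinv_le_contravar; [apply lt_0_INR; lia | apply le_INR; lia]. }
  assert (Ex : forall n, exists huw : H * H * H,
    B (fst (fst huw)) (snd (fst huw)) /\ B (snd (fst huw)) (snd huw) /\
    snd huw -: s n *: fst (fst huw) = f).
  { intro n. destruct (square_factors (s n)) as [_ On].
    { split; [apply s0 |]. apply Rle_lt_trans with (1 := s1 n). lra. }
    destruct (On f) as [h [w [[u [Bhu Buw]] E]]]. exists (h, u, w). auto. }
  set (sol := fun n => proj1_sig (constructive_indefinite_description _ (Ex n))).
  set (h := fun n => fst (fst (sol n))).
  set (u := fun n => snd (fst (sol n))).
  set (w := fun n => snd (sol n)).
  assert (Hs : forall n, B (h n) (u n) /\ B (u n) (w n) /\ w n -: s n *: h n = f)
    by (intro n; exact (proj2_sig (constructive_indefinite_description _ (Ex n)))).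
  clearbody h u w. clear sol Ex.
  assert (f0 := norm_ge_0 f).
  assert (Nh : forall n, s n * norm (h n) <= norm f).
  { intro n. destruct (Hs n) as [B1 [B2 <-]].
    apply square_gap; [split; [apply s0 | apply s1] | exists (u n); auto]. }
  assert (Nu : forall n, gamma * norm (u n) <= 2 * norm f).
  { intro n. destruct (Hs n) as [B1 [B2 E]].
    apply Rle_trans with (1 := range_gap _ _ _ B1 B2).
    replace (w n) with (f +: s n *: h n) by (rewrite <- E; hilbert_ring).
    apply Rle_trans with (1 := norm_vadd_le _ _).
    rewrite norm_vscalR, Rabs_pos_eq by (apply Rlt_le, s0).
    assert (A := Nh n). lra. }
  set (q := fun n => f -: w n).
  set (v := fun n => (- s n)%R *: u n).
  assert (Bq : forall n, B (q n) (v n)).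
  { intro n. destruct (Hs n) as [B1 [B2 E]].
    replace (q n) with (h n +: (- s n - 1)%R *: h n)
      by (unfold q; rewrite <- E; hilbert_ring).
    replace (v n) with (u n +: (- s n - 1)%R *: u n) by (unfold v; hilbert_ring).
    apply B_linear; assumption. }
  assert (Nv : forall n, gamma * norm (v n) <= 2 * norm f * s n).
  { intro n. unfold v. rewrite norm_vscalR, Rabs_Ropp, Rabs_pos_eq
      by (apply Rlt_le, s0).
    assert (A := Nu n). assert (A' := s0 n). nra. }
  assert (vl : forall eps, 0 < eps -> exists N, forall n, (N <= n)%nat ->
            norm (v n) < eps).
  { intros eps ep.
    destruct (sl (gamma * eps / (2 * norm f + 1))) as [N HN].
    { apply Rdiv_lt_0_compat; [apply Rmult_lt_0_compat |]; lra. }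
    exists N. intros n Hn. assert (A := HN n Hn). assert (A' := s0 n).
    apply (Rmult_lt_reg_l gamma); [exact gamma_pos |].
    apply Rle_lt_trans with (1 := Nv n).
    apply (Rmult_lt_compat_r (2 * norm f + 1)) in A; [| lra].
    replace (gamma * eps / (2 * norm f + 1) * (2 * norm f + 1))
      with (gamma * eps) in A by (field; lra). nra. }
  destruct (cauchy_limit q) as [p Hp].
  { intros eps ep. destruct (vl (gamma * eps / 2)) as [N HN].
    { apply Rdiv_lt_0_compat; [apply Rmult_lt_0_compat |]; lra. }
    exists N. intros n m Hn Hm.
    assert (A : gamma * norm (q n -: q m) <= norm (v n -: v m)).
    { apply (range_gap (u m -: u n)); [| apply linear_graph_sub; apply Bq].
      replace (q n -: q m) with (w m -: w n) by (unfold q; hilbert_ring).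
      apply linear_graph_sub; apply Hs. }
    assert (A1 := norm_vsub_le (v n) (v m)).
    assert (A2 := HN n Hn). assert (A3 := HN m Hm). nra. }
  exists p. intros eps ep.
  destruct (vl eps ep) as [N1 H1]. destruct (Hp eps ep) as [N2 H2].
  set (n := (N1 + N2)%nat).
  exists (u n), (w n), (q n), (v n).
  destruct (Hs n) as [_ [Buw _]].
  split; [exact Buw |]. split; [unfold q; hilbert_ring |].
  split; [apply Nu |]. split; [apply H2; unfold n; lia |].
  split; [apply Bq | apply H1; unfold n; lia].
Qed.

End IsolatedZero.

(** * Curves in a Hilbert space *)

Section Curves.

Context {H : HilbertSpace}.

Definition continuous_curve (f : R -> H) : Prop :=
  forall t, @continuous R_UniformSpace (real_module H) f t.

Definition derivative (f : R -> H) (t : R) (l : H) : Prop :=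
  @is_derive R_AbsRing (real_module H) f t l.

Definition integral (f : R -> H) (a b : R) : H := @RInt (real_module H) f a b.

Lemma integral_correct f a b : continuous_curve f ->
  @is_RInt (real_module H) f a b (integral f a b).
Proof.
  intro Cf. apply (@RInt_correct (real_module H)).
  apply (@ex_RInt_continuous (real_module H)). intros t _. apply Cf.
Qed.

Lemma integral_unique f a b l :
  @is_RInt (real_module H) f a b l -> integral f a b = l.
Proof. exact (@is_RInt_unique (real_module H) f a b l). Qed.

Lemma integral_ext f g a b : (forall t, f t = g t) -> integral f a b = integral g a b.
Proof. intro E. apply (@RInt_ext (real_module H)). intros t _. apply E. Qed.

Lemma continuous_const_curve x : continuous_curve (fun _ => x).
Proof. intro t. exact (@continuous_const R_UniformSpace (real_module H) x t). Qed.

Lemma integral_vadd f g a b : continuous_curve f -> continuous_curve g ->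
  integral (fun t => f t +: g t) a b = integral f a b +: integral g a b.
Proof.
  intros Cf Cg. apply integral_unique.
  exact (@is_RInt_plus (real_module H) f g a b _ _
           (integral_correct f a b Cf) (integral_correct g a b Cg)).
Qed.

Lemma integral_const x a b : integral (fun _ => x) a b = (b - a)%R *: x.
Proof. exact (@RInt_const (real_module H) a b x). Qed.

Lemma integral_point f a : integral f a a = vzero.
Proof. exact (@RInt_point (real_module H) a f). Qed.

Lemma integral_chasles f a b c : continuous_curve f ->
  integral f a b +: integral f b c = integral f a c.
Proof.
  intro Cf. symmetry. apply integral_unique.
  exact (@is_RInt_Chasles (real_module H) f a b c _ _
           (integral_correct f a b Cf) (integral_correct f b c Cf)).
Qed.

Lemma integral_shift f h a b : continuous_curve f ->
  integral (fun t => f (t + h)) a b = integral f (a + h) (b + h).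
Proof.
  intro Cf. apply integral_unique.
  assert (A := @is_RInt_comp_lin (real_module H) f 1 h a b (integral f (a + h) (b + h))).
  rewrite !Rmult_1_l in A.
  eapply (@is_RInt_ext (real_module H)); [| exact (A (integral_correct f _ _ Cf))].
  intros t _. simpl. rewrite Rmult_1_l.
  exact (@scal_one R_Ring (real_module H) (f (t + h))).
Qed.

Lemma integral_bound f a b M : continuous_curve f -> a <= b ->
  (forall t, a <= t <= b -> norm (f t) <= M) ->
  norm (integral f a b) <= M * (b - a).
Proof.
  intros Cf ab Bf.
  rewrite Rmult_comm.
  apply (@norm_RInt_le (real_module H) f (fun _ => M) a b); [exact ab | exact Bf | |].
  - exact (integral_correct f a b Cf).
  - exact (@is_RInt_const R_NormedModule a b M).
Qed.

Lemma integral_derivative f f' a b :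
  (forall t, derivative f t (f' t)) -> continuous_curve f' ->
  integral f' a b = f b -: f a.
Proof.
  intros Df Cf. apply integral_unique.
  apply (@is_RInt_derive (real_module H) f f' a b); intros t _; [apply Df | apply Cf].
Qed.

Lemma derivative_integral f a b : continuous_curve f ->
  derivative (fun t => integral f a t) b (f b).
Proof.
  intro Cf. apply (@is_derive_RInt (real_module H) f _ a b); [| apply Cf].
  apply filter_forall. intro t. apply integral_correct, Cf.
Qed.

Lemma derivative_continuous f f' :
  (forall t, derivative f t (f' t)) -> continuous_curve f.
Proof.
  intros Df t. apply (@ex_derive_continuous R_AbsRing (real_module H)).
  exists (f' t). apply Df.
Qed.

Lemma derivative_ext f g t l :
  (forall r, f r = g r) -> derivative f t l -> derivative g t l.
Proof. exact (@is_derive_ext R_AbsRing (real_module H) f g t l). Qed.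

Lemma derivative_vsub f g t l m :
  derivative f t l -> derivative g t m -> derivative (fun r => f r -: g r) t (l -: m).
Proof. exact (@is_derive_minus R_AbsRing (real_module H) f g t l m). Qed.

Lemma derivative_vadd f g t l m :
  derivative f t l -> derivative g t m -> derivative (fun r => f r +: g r) t (l +: m).
Proof. exact (@is_derive_plus R_AbsRing (real_module H) f g t l m). Qed.

Lemma derivative_const x t : derivative (fun _ => x) t vzero.
Proof. exact (@is_derive_const R_AbsRing (real_module H) x t). Qed.

Lemma derivative_shift f h t l :
  derivative f (t + h) l -> derivative (fun r => f (r + h)) t l.
Proof.
  intro Df.
  replace l with (@scal R_AbsRing (real_module H) 1 l)
    by exact (@scal_one R_Ring (real_module H) l).
  apply (@is_derive_comp R_AbsRing (real_module H) f (fun r => r + h)); [exact Df |].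
  change (is_derive (fun r : R => r + h) t 1). auto_derive; [exact I | ring].
Qed.

End Curves.

Lemma is_linear_real {H H' : HilbertSpace} (L : H -> H') :
  is_linear L -> @is_linear R_AbsRing (real_module H) (real_module H') L.
Proof.
  intros [L1 L2 L3]. split; [exact L1 | | exact L3].
  intros k x. exact (L2 (RtoC k) x).
Qed.

Lemma rdot_linear {H : HilbertSpace} (z : H) :
  @is_linear R_AbsRing (real_module H) R_NormedModule (fun x => rdot (x : H) z).
Proof.
  split.
  - intros x y. exact (rdot_vadd_l x y z).
  - intros k x. exact (rdot_vscal_l k x z).
  - exists (norm z + 1). assert (K := norm_ge_0 z). split; [lra |].
    intro x. apply Rle_trans with (1 := rdot_bound (x : H) z).
    assert (K' := norm_ge_0 (x : H)).
    change (@norm R_AbsRing (real_module H) x) with (norm (x : H)). nra.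
Qed.

Lemma is_derive_linear {V W : NormedModule R_AbsRing} (L : V -> W) (f : R -> V) t l :
  is_linear L -> is_derive f t l -> is_derive (fun r => L (f r)) t (L l).
Proof.
  intros HL Df. unfold is_derive.
  apply filterdiff_ext_lin with (fun r : R_AbsRing => L (scal r l)).
  - apply (filterdiff_comp' (U := R_NormedModule) f L t (fun r => scal r l) L); [exact Df |].
    apply filterdiff_linear, HL.
  - intro r. apply (linear_scal L HL).
Qed.

Lemma is_RInt_linear {V W : NormedModule R_AbsRing} (L : V -> W) (f : R -> V) a b l :
  is_linear L -> is_RInt f a b l -> is_RInt (fun r => L (f r)) a b (L l).
Proof.
  intros HL If. unfold is_RInt.
  apply filterlim_ext with (fun ptd => L (scal (sign (b - a)) (Riemann_sum f ptd))).
  - intro ptd. rewrite (linear_scal L HL). f_equal.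
    apply (SF_cons_ind (fun ptd => L (Riemann_sum f ptd) = Riemann_sum (fun r => L (f r)) ptd)).
    + intro x. apply (linear_zero L HL).
    + intros h s IH. rewrite !Riemann_sum_cons, (linear_plus L HL), (linear_scal L HL), IH.
      reflexivity.
  - apply filterlim_comp with (1 := If). exact (linear_cont L l HL).
Qed.

Section LinearMaps.

Context {H : HilbertSpace} (L : H -> H).
Hypothesis L_linear : is_linear L.

Lemma map_vadd x y : L (x +: y) = L x +: L y.
Proof. exact (linear_plus L L_linear x y). Qed.

Lemma map_vscal a x : L (a *: x) = a *: L x.
Proof. exact (linear_scal L L_linear a x). Qed.

Lemma map_vsub x y : L (x -: y) = L x -: L y.
Proof. rewrite !vsub_eq, map_vadd, map_vscal. reflexivity. Qed.

Lemma continuous_linear f : continuous_curve f -> continuous_curve (fun t => L (f t)).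
Proof.
  intros Cf t.
  apply (@continuous_comp R_UniformSpace (real_module H) (real_module H) f L); [apply Cf |].
  apply (@linear_cont R_AbsRing (real_module H) (real_module H)), is_linear_real, L_linear.
Qed.

Lemma integral_linear f a b : continuous_curve f ->
  L (integral f a b) = integral (fun t => L (f t)) a b.
Proof.
  intro Cf. symmetry. apply integral_unique.
  apply (@is_RInt_linear (real_module H) (real_module H) L f);
    [apply is_linear_real, L_linear | apply integral_correct, Cf].
Qed.

Lemma derivative_linear f t l :
  derivative f t l -> derivative (fun r => L (f r)) t (L l).
Proof.
  apply (@is_derive_linear (real_module H) (real_module H) L f t l).
  apply is_linear_real, L_linear.
Qed.

End LinearMaps.

Lemma vscal_linear {H : HilbertSpace} (a : C) : is_linear (fun x : H => a *: x).
Proof. exact (@is_linear_scal_r C_AbsRing H a Cmult_comm). Qed.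

(** * The group, its generator and its averages *)

Section UnitaryGroup.

Context {H : HilbertSpace} (U : R -> H -> H) (P : H -> H).
Hypothesis hU : unitary_group U.
Hypothesis hP : orthogonal_projection (fixed_space U) P.

Lemma U_linear t : is_linear (U t).
Proof. exact (proj1 (group_unitary U hU t)). Qed.

Lemma U_inner t x y : inner (U t x) (U t y) = inner x y.
Proof. exact (proj1 (proj2 (group_unitary U hU t)) x y). Qed.

Lemma U_norm t x : norm (U t x) = norm x.
Proof.
  apply Rsqr_inj; try apply norm_ge_0.
  rewrite !Rsqr_pow2, !norm_sq. unfold rdot. rewrite U_inner. reflexivity.
Qed.

Lemma U_zero x : U 0 x = x.
Proof. exact (group_zero U hU x). Qed.

Lemma U_plus s t x : U (s + t) x = U s (U t x).
Proof. exact (group_plus U hU s t x). Qed.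

Lemma orbit_continuous x : continuous_curve (fun t => U t x).
Proof. intro t. exact (group_continuous U hU x t). Qed.

Local Notation B := (generator U).

Lemma generator_intro f g : derivative (fun t => U t f) 0 (Ci *: g) -> B f g.
Proof. exact (fun D => D). Qed.

Lemma orbit_derivative f g : B f g ->
  forall t, derivative (fun r => U r f) t (Ci *: U t g).
Proof.
  intros Bfg t.
  rewrite <- (map_vscal _ (U_linear t)).
  apply derivative_ext with (fun r => U t (U (r + - t) f)).
  { intro r. rewrite <- U_plus. f_equal. ring. }
  apply derivative_linear; [apply U_linear |].
  apply (derivative_shift (fun r => U r f)).
  rewrite Rplus_opp_r. exact Bfg.
Qed.

Lemma orbit_increment f g s t : B f g ->
  Ci *: integral (fun r => U r g) s t = U t f -: U s f.
Proof.
  intro Bfg.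
  rewrite (integral_linear (fun x => Ci *: x) (vscal_linear Ci))
    by apply orbit_continuous.
  apply (integral_derivative (fun r => U r f)).
  - exact (orbit_derivative f g Bfg).
  - apply (continuous_linear (fun x => Ci *: x) (vscal_linear Ci)), orbit_continuous.
Qed.

Lemma generator_linear : linear_graph B.
Proof.
  intros f g f' g' a Bf Bf'. apply generator_intro.
  replace (Ci *: (g +: a *: g')) with (Ci *: g +: a *: (Ci *: g')) by hilbert_ring.
  apply derivative_ext with (fun t => U t f +: a *: U t f').
  { intro t. rewrite (map_vadd _ (U_linear t)), (map_vscal _ (U_linear t)). reflexivity. }
  apply derivative_vadd; [exact Bf |].
  exact (derivative_linear (fun x => a *: x) (vscal_linear a) _ _ _ Bf').
Qed.

Lemma rdot_derivative (f : R -> H) t (l z : H) : derivative f t l ->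
  is_derive (fun r => rdot (f r) z) t (rdot l z).
Proof.
  exact (@is_derive_linear (real_module H) R_NormedModule _ f t l (rdot_linear z)).
Qed.

(** Differentiating [(U^t f, f') = (f, U^(-t) f')] at [0]. *)
Lemma generator_skew f g f' g' : B f g -> B f' g' ->
  rdot (Ci *: g) f' = - rdot f (Ci *: g').
Proof.
  intros Bf Bf'.
  assert (D1 : Derive (fun t => rdot (U t f) f') 0 = rdot (Ci *: g) f')
    by exact (is_derive_unique _ _ _ (rdot_derivative _ _ _ f' Bf)).
  assert (D2 : is_derive (fun t => rdot (U (- t) f') f) 0 (- rdot (Ci *: g') f)).
  { replace (- rdot (Ci *: g') f) with (@scal R_AbsRing R_NormedModule (-1) (rdot (Ci *: g') f))
      by (change (-1 * rdot (Ci *: g') f = - rdot (Ci *: g') f); ring).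
    apply (@is_derive_comp R_AbsRing R_NormedModule (fun t => rdot (U t f') f) (fun t => - t)).
    - rewrite Ropp_0. exact (rdot_derivative _ _ _ f Bf').
    - change (is_derive (fun t : R => - t) 0 (-1)). auto_derive; [exact I | ring]. }
  apply is_derive_unique in D2.
  rewrite (rdot_sym f), <- D1, <- D2. apply Derive_ext. intro t.
  rewrite (rdot_sym (U (- t) f')).
  unfold rdot. rewrite <- (U_inner (- t) (U t f) f'), <- U_plus.
  rewrite Rplus_opp_l, U_zero. reflexivity.
Qed.

(** Taking [i f'] for [f'] in [generator_skew] removes the factor [i] from both
    sides. *)
Lemma generator_symmetric : symmetric_graph B.
Proof.
  intros f g f' g' Bf Bf'.
  assert (Bi : B (vzero +: Ci *: f') (vzero +: Ci *: g')).
  { apply generator_linear; [| exact Bf']. apply generator_intro.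
    replace (Ci *: @vzero H) with (@vzero H) by hilbert_ring.
    apply derivative_ext with (fun _ => vzero); [| apply derivative_const].
    intro t. symmetry. exact (linear_zero _ (U_linear t)). }
  assert (E := generator_skew _ _ _ _ Bf Bi).
  replace (vzero +: Ci *: f') with (Ci *: f') in E by hilbert_ring.
  replace (Ci *: (vzero +: Ci *: g')) with ((- (1))%R *: g') in E.
  - rewrite rdot_Ci, rdot_vscal_r in E. lra.
  - apply inner_ext. intro z. rewrite !inner_vscal, inner_vadd, inner_vzero, inner_vscal.
    apply injective_projections; simpl; ring.
Qed.

Lemma projection_unique f m : fixed_space U m ->
  (forall n, fixed_space U n -> inner (f -: m) n = 0%C) -> P f = m.
Proof.
  intros Fm Om. destruct (hP f) as [FP OP].
  assert (Fd : fixed_space U (P f -: m)).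
  { intro t. rewrite (map_vsub _ (U_linear t)), FP, Fm. reflexivity. }
  apply vsub_eq_zero, norm_eq_vzero.
  assert (E : inner (P f -: m) (P f -: m) = 0%C).
  { replace (P f -: m) with ((f -: m) -: (f -: P f)) at 1 by hilbert_ring.
    rewrite inner_vsub, (Om _ Fd). unfold vsub at 1. rewrite (OP _ Fd). ring. }
  assert (N := norm_sq (P f -: m)). unfold rdot in N. rewrite E in N.
  simpl in N. nra.
Qed.

Lemma projection_orthogonal f n : fixed_space U n -> inner (f -: P f) n = 0%C.
Proof. exact (proj2 (hP f) n). Qed.

Lemma projection_fixed f t : U t (P f) = P f.
Proof. exact (proj1 (hP f) t). Qed.

Lemma projection_of_fixed f : fixed_space U f -> P f = f.
Proof.
  intro F. apply projection_unique; [exact F |]. intros n _.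
  replace (f -: f) with (@vzero H) by hilbert_ring. apply inner_vzero.
Qed.

Lemma projection_pythagoras f : norm f ^ 2 = norm (f -: P f) ^ 2 + norm (P f) ^ 2.
Proof.
  assert (O : rdot (f -: P f) (P f) = 0).
  { unfold rdot. rewrite projection_orthogonal; [reflexivity |].
    intro t. apply projection_fixed. }
  replace f with ((f -: P f) +: P f) at 1 by hilbert_ring.
  rewrite !norm_sq, rdot_vadd_l, (rdot_vadd_r _ _ (f -: P f)), (rdot_vadd_r _ _ (P f)).
  rewrite (rdot_sym (P f) (f -: P f)), O. ring.
Qed.

Lemma projection_norm f : norm (P f) <= norm f.
Proof.
  apply Rsqr_incr_0_var; [| apply norm_ge_0]. rewrite !Rsqr_pow2.
  assert (E := projection_pythagoras f). nra.
Qed.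

Lemma projection_complement_norm f : norm (f -: P f) <= norm f.
Proof.
  apply Rsqr_incr_0_var; [| apply norm_ge_0]. rewrite !Rsqr_pow2.
  assert (E := projection_pythagoras f). nra.
Qed.

Lemma projection_linear : is_linear P.
Proof.
  split.
  - intros x y. apply (projection_unique (x +: y) (P x +: P y)).
    + intro t. rewrite (map_vadd _ (U_linear t)), !projection_fixed. reflexivity.
    + intros n Fn.
      replace (x +: y -: (P x +: P y)) with ((x -: P x) +: (y -: P y)) by hilbert_ring.
      rewrite inner_vadd, !projection_orthogonal by exact Fn. ring.
  - intros a x. apply (projection_unique (a *: x) (a *: P x)).
    + intro t. rewrite (map_vscal _ (U_linear t)), projection_fixed. reflexivity.
    + intros n Fn.
      replace (a *: x -: a *: P x) with (a *: (x -: P x)) by hilbert_ring.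
      rewrite inner_vscal, projection_orthogonal by exact Fn. ring.
  - exists 1. split; [lra |]. intro x. rewrite Rmult_1_l. apply projection_norm.
Qed.

Lemma projection_U t f : P (U t f) = P f.
Proof.
  apply projection_unique; [intro r; apply projection_fixed |].
  intros n Fn. rewrite <- (projection_fixed f t), <- (map_vsub _ (U_linear t)).
  rewrite <- (Fn t), U_inner. apply projection_orthogonal, Fn.
Qed.

Lemma projection_integral f a b : continuous_curve f ->
  (forall t, P (f t) = vzero) -> P (integral f a b) = vzero.
Proof.
  intros Cf Z. rewrite (integral_linear P projection_linear) by exact Cf.
  rewrite (integral_ext _ (fun _ => vzero)), integral_const by exact Z. hilbert_ring.
Qed.

(** Apply [P] to [i int_0^1 U^r g dr = U^1 f - f], using [P U^r = P]. *)
Lemma projection_generator f g : B f g -> P g = vzero.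
Proof.
  intro Bfg.
  assert (E := f_equal P (orbit_increment f g 0 1 Bfg)).
  rewrite (map_vsub _ projection_linear), !projection_U, (map_vscal _ projection_linear) in E.
  rewrite (integral_linear P projection_linear), (integral_ext _ (fun _ => P g)),
    integral_const in E by (apply orbit_continuous || (intro; apply projection_U)).
  assert (N := f_equal (@norm C_AbsRing H) E).
  replace (P f -: P f) with (@vzero H) in N by hilbert_ring.
  rewrite norm_vscal, norm_vscalR, norm_vzero, Rminus_0_r, Rabs_R1, Cmod_Ci in N.
  apply norm_eq_vzero. lra.
Qed.

Lemma generator_projection f : B (P f) vzero.
Proof.
  apply generator_intro.
  replace (Ci *: @vzero H) with (@vzero H) by hilbert_ring.
  apply derivative_ext with (fun _ => P f); [| apply derivative_const].
  intro t. symmetry. apply projection_fixed.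
Qed.

Lemma ergodic_average_integral t s f :
  ergodic_average U t s f = (/ (t - s))%R *: integral (fun r => U r f) s t.
Proof. reflexivity. Qed.

Lemma orbit_integral_bound f s t : s <= t ->
  norm (integral (fun r => U r f) s t) <= norm f * (t - s).
Proof.
  intro st. apply integral_bound; [apply orbit_continuous | exact st |].
  intros r _. rewrite U_norm. lra.
Qed.

Lemma average_norm t s f : s < t -> norm (ergodic_average U t s f) <= norm f.
Proof.
  intro st. assert (ip : 0 < / (t - s)) by (apply Rinv_0_lt_compat; lra).
  rewrite ergodic_average_integral, norm_vscalR, Rabs_pos_eq by lra.
  apply (Rmult_le_reg_l (t - s)); [lra |].
  rewrite <- Rmult_assoc, Rinv_r, Rmult_1_l by lra.
  rewrite Rmult_comm. apply orbit_integral_bound. lra.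
Qed.

Lemma average_vadd t s f g :
  ergodic_average U t s (f +: g) = ergodic_average U t s f +: ergodic_average U t s g.
Proof.
  rewrite !ergodic_average_integral.
  rewrite (integral_ext _ (fun r => U r f +: U r g))
    by (intro r; apply (map_vadd _ (U_linear r))).
  rewrite integral_vadd by apply orbit_continuous. hilbert_ring.
Qed.

(** The average of [U^r g] for [g = B f] telescopes to [(U^t f - U^s f) / (i (t - s))]. *)
Lemma average_range t s f g : s < t -> B f g ->
  norm (ergodic_average U t s g) <= 2 * norm f / (t - s).
Proof.
  intros st Bfg. assert (ip : 0 < / (t - s)) by (apply Rinv_0_lt_compat; lra).
  rewrite ergodic_average_integral, norm_vscalR, Rabs_pos_eq by lra.
  unfold Rdiv. rewrite Rmult_comm. apply Rmult_le_compat_r; [lra |].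
  assert (E := f_equal (@norm C_AbsRing H) (orbit_increment f g s t Bfg)).
  rewrite norm_vscal, Cmod_Ci, Rmult_1_l in E. rewrite E.
  apply Rle_trans with (1 := norm_vsub_le _ _). rewrite !U_norm. lra.
Qed.

Lemma average_fixed t s f : s < t -> fixed_space U f -> ergodic_average U t s f = f.
Proof.
  intros st F. rewrite ergodic_average_integral.
  rewrite (integral_ext _ (fun _ => f)), integral_const by exact F.
  hilbert_ring. rewrite <- (Cmult_1_l (inner f z)) at 2. rewrite Cmult_assoc.
  f_equal. rewrite <- RtoC_minus, <- RtoC_mult. f_equal. field. lra.
Qed.

Lemma average_vscal t s a f :
  ergodic_average U t s (a *: f) = a *: ergodic_average U t s f.
Proof.
  rewrite !ergodic_average_integral.
  rewrite (integral_ext _ (fun r => a *: U r f))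
    by (intro r; apply (map_vscal _ (U_linear r))).
  rewrite <- (integral_linear (fun x => a *: x) (vscal_linear a))
    by apply orbit_continuous. hilbert_ring.
Qed.

Lemma average_vsub t s f g :
  ergodic_average U t s (f -: g) = ergodic_average U t s f -: ergodic_average U t s g.
Proof. rewrite !vsub_eq, average_vadd, average_vscal. reflexivity. Qed.

End UnitaryGroup.

(** * From a spectral gap to uniform convergence *)

Section GapToConvergence.

Context {H : HilbertSpace} (U : R -> H -> H) (P : H -> H) (gamma : R).
Hypothesis hU : unitary_group U.
Hypothesis hP : orthogonal_projection (fixed_space U) P.
Hypothesis gamma_pos : 0 < gamma.
Hypothesis gap : forall lambda : R,
  - gamma < lambda < gamma -> lambda <> 0 -> resolvent_set (generator U) lambda.

(** The vectors [q] of [kernel_approximation] have small image under [B], so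
    the group almost fixes them and their limit is fixed.  Since [P] vanishes on
    the range of [B], that limit is [P f]. *)
Lemma range_approximation (f : H) eps : 0 < eps -> exists u w,
  generator U u w /\ gamma * norm u <= 2 * norm f /\ norm (f -: w -: P f) < eps.
Proof.
  intro ep.
  destruct (kernel_approximation (generator U) gamma (generator_linear U hU)
    (generator_symmetric U hU) gamma_pos gap f) as [p Hp].
  assert (Fwd : forall t, 0 <= t -> U t p = p).
  { intros t t0. apply vsub_eq_zero, norm_eq_vzero, Rle_antisym; [| apply norm_ge_0].
    apply le_epsilon. intros d dp. rewrite Rplus_0_l.
    destruct (Hp (d / (t + 2))) as [_ [_ [q [v [_ [_ [_ [Hq [Bq Hv]]]]]]]]].
    { apply Rdiv_lt_0_compat; lra. }
    set (e := d / (t + 2)) in *.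
    assert (de : d = t * e + 2 * e) by (unfold e; field; lra).
    assert (ep' : 0 < e) by (apply Rdiv_lt_0_compat; lra).
    replace (U t p -: p) with ((U t q -: q) -: (U t (q -: p) -: (q -: p)))
      by (rewrite (map_vsub _ (U_linear U hU t)); hilbert_ring).
    apply Rle_trans with (1 := norm_vsub_le _ _).
    assert (N1 := norm_vsub_le (U t (q -: p)) (q -: p)).
    rewrite (U_norm U hU) in N1.
    assert (E := orbit_increment U hU q v 0 t Bq). rewrite (U_zero U hU) in E.
    rewrite <- E, norm_vscal, Cmod_Ci, Rmult_1_l.
    assert (N2 := orbit_integral_bound U hU v 0 t t0). nra. }
  assert (Fp : fixed_space U p).
  { intro t. destruct (Rle_lt_dec 0 t) as [t0 | t0]; [apply Fwd, t0 |].
    rewrite <- (Fwd (- t)) at 1 by lra.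
    rewrite <- (U_plus U hU), Rplus_opp_r. apply (U_zero U hU). }
  assert (Pp : P f = p).
  { apply vsub_eq_zero, norm_eq_vzero, Rle_antisym; [| apply norm_ge_0].
    apply le_epsilon. intros d dp. rewrite Rplus_0_l.
    destruct (Hp d dp) as [u [w [q [v [Bu [Ef [_ [Hq _]]]]]]]].
    rewrite Ef, (map_vadd _ (projection_linear U P hU hP)),
      (projection_generator U P hU hP u w Bu).
    rewrite <- (projection_of_fixed U P hU hP p Fp) at 1.
    replace (vzero +: P q -: P p) with (P q -: P p) by hilbert_ring.
    rewrite <- (map_vsub _ (projection_linear U P hU hP)).
    apply Rle_trans with (1 := projection_norm U P hP _). lra. }
  destruct (Hp eps ep) as [u [w [q [v [Bu [Ef [Nu [Hq _]]]]]]]].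
  exists u, w. split; [exact Bu |]. split; [exact Nu |].
  rewrite Pp. replace (f -: w) with q by (rewrite Ef; hilbert_ring). exact Hq.
Qed.

Lemma average_rate (f : H) t s : s < t ->
  norm (ergodic_average U t s f -: P f) <= 4 * norm f / (gamma * (t - s)).
Proof.
  intro st. apply le_epsilon. intros eps ep.
  destruct (range_approximation f eps ep) as [u [w [Bu [Nu Nq]]]].
  replace (ergodic_average U t s f -: P f)
    with (ergodic_average U t s w +: ergodic_average U t s (f -: w -: P f)).
  2:{ rewrite !(average_vsub U hU), (average_fixed U t s (P f) st (projection_fixed U P hP f)).
      hilbert_ring. }
  apply Rle_trans with (1 := norm_vadd_le _ _).
  assert (N1 := average_range U hU t s u w st Bu).
  assert (N2 := average_norm U hU t s (f -: w -: P f) st).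
  apply Rplus_le_compat; [| lra].
  apply Rle_trans with (1 := N1).
  apply (Rmult_le_reg_r (gamma * (t - s))); [apply Rmult_lt_0_compat; lra |].
  replace (2 * norm u / (t - s) * (gamma * (t - s))) with (2 * (gamma * norm u))
    by (field; lra).
  replace (4 * norm f / (gamma * (t - s)) * (gamma * (t - s))) with (4 * norm f)
    by (field; lra).
  lra.
Qed.

Lemma gap_uniform_convergence : uniform_ergodic_convergence U P.
Proof.
  intros eps ep. exists (4 / (gamma * eps)). intros t s st Ht.
  assert (ge : 0 < gamma * eps) by (apply Rmult_lt_0_compat; assumption).
  assert (gt : 0 < gamma * (t - s)) by (apply Rmult_lt_0_compat; lra).
  apply Rbar_le_lt_trans with (4 / (gamma * (t - s))).
  - apply (proj2 (Lub_Rbar_correct _)). intros r [f [Nf ->]].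
    apply Rle_trans with (1 := average_rate f t s st).
    apply Rmult_le_compat_r; [apply Rlt_le, Rinv_0_lt_compat, gt | lra].
  - simpl. apply (Rmult_lt_reg_r (gamma * (t - s))); [exact gt |].
    replace (4 / (gamma * (t - s)) * (gamma * (t - s))) with 4 by (field; lra).
    apply (Rmult_lt_compat_r (gamma * eps)) in Ht; [| exact ge].
    replace (4 / (gamma * eps) * (gamma * eps)) with 4 in Ht by (field; lra). lra.
Qed.

End GapToConvergence.

(** * From uniform convergence to a spectral gap *)

(** The estimate from below makes the solution of [B f - lambda f = x] unique,
    hence linear in [x], and bounds it. *)
Lemma resolvent_of_onto {H : HilbertSpace} (B : graph H) (lambda : R) :
  linear_graph B -> bounded_below B lambda -> onto B lambda -> resolvent_set B lambda.
Proof.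
  intros LB [K [Kp HK]] On.
  assert (Uniq : forall f g f' g', B f g -> B f' g' ->
    g -: lambda *: f = g' -: lambda *: f' -> f = f').
  { intros f g f' g' Bf Bf' E. apply vsub_eq_zero, norm_eq_vzero, Rle_antisym;
      [| apply norm_ge_0].
    apply Rle_trans with (1 := HK _ _ (linear_graph_sub B LB _ _ _ _ Bf Bf')).
    replace (g -: g' -: lambda *: (f -: f'))
      with ((g -: lambda *: f) -: (g' -: lambda *: f')) by hilbert_ring.
    rewrite E.
    replace (g' -: lambda *: f' -: (g' -: lambda *: f')) with (@vzero H) by hilbert_ring.
    rewrite norm_vzero. lra. }
  set (S := fun x => proj1_sig (constructive_indefinite_description _ (On x))).
  assert (HS : forall x, exists g, B (S x) g /\ g -: lambda *: S x = x)
    by (intro x; exact (proj2_sig (constructive_indefinite_description _ (On x)))).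
  clearbody S. exists S. repeat split.
  - intros x y. change (S (x +: y) = S x +: S y).
    destruct (HS x) as [g [Bg E]]. destruct (HS y) as [g' [Bg' E']].
    destruct (HS (x +: y)) as [k [Bk E2]].
    apply (Uniq _ k _ (g +: 1%C *: g')); [exact Bk | |].
    + replace (S x +: S y) with (S x +: 1%C *: S y) by hilbert_ring.
      apply LB; assumption.
    + rewrite E2, <- E, <- E' at 1. hilbert_ring.
  - intros a x. change (S (a *: x) = a *: S x).
    destruct (HS x) as [g [Bg E]]. destruct (HS (a *: x)) as [k [Bk E2]].
    apply (Uniq _ k _ (a *: g)); [exact Bk | |].
    + replace (a *: S x) with (S x +: (a - 1)%C *: S x) by hilbert_ring.
      replace (a *: g) with (g +: (a - 1)%C *: g) by hilbert_ring.
      apply LB; assumption.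
    + rewrite E2, <- E at 1. hilbert_ring.
  - exists K. split; [exact Kp |]. intro x. destruct (HS x) as [g [Bg E]].
    rewrite <- E at 2. apply HK, Bg.
  - intro y. destruct (HS y) as [g [Bg E]]. exists g. split; [exact Bg | exact E].
  - intros f g Bf. change (S (g -: lambda *: f) = f).
    destruct (HS (g -: lambda *: f)) as [k [Bk E]].
    exact (Uniq _ _ _ _ Bk Bf E).
Qed.

Section ConvergenceToGap.

Context {H : HilbertSpace} (U : R -> H -> H) (P : H -> H) (T : R).
Hypothesis hU : unitary_group U.
Hypothesis hP : orthogonal_projection (fixed_space U) P.
Hypothesis T_pos : 0 < T.
Hypothesis close : forall f : H,
  norm (ergodic_average U T 0 f -: P f) <= / 2 * norm f.

Definition orbit_primitive (f : H) (t : R) : H := integral (fun r => U r f) 0 t.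

Definition double_integral (f : H) : H := integral (orbit_primitive f) 0 T.

Lemma orbit_primitive_continuous f : continuous_curve (orbit_primitive f).
Proof.
  apply derivative_continuous with (fun t => U t f). intro t.
  apply (derivative_integral (fun r => U r f) 0 t), orbit_continuous, hU.
Qed.

Lemma orbit_primitive_shift f h t :
  U h (orbit_primitive f t) = orbit_primitive f (t + h) -: orbit_primitive f h.
Proof.
  unfold orbit_primitive at 1.
  rewrite (integral_linear _ (U_linear U hU h)) by apply orbit_continuous, hU.
  rewrite (integral_ext _ (fun r => U (r + h) f)).
  2:{ intro r. rewrite <- (U_plus U hU). f_equal. ring. }
  rewrite (integral_shift (fun r => U r f)) by apply orbit_continuous, hU.
  unfold orbit_primitive.
  rewrite <- (integral_chasles (fun r => U r f) 0 h (t + h)) by apply orbit_continuous, hU.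
  rewrite Rplus_0_l. hilbert_ring.
Qed.

(** [U^h] moves both integration windows, so that the derivative at [h = 0]
    only sees their end points. *)
Lemma generator_double_integral f :
  generator U (double_integral f)
    (Copp Ci *: (integral (fun r => U r f) 0 T -: T *: f)).
Proof.
  apply generator_intro.
  set (F := orbit_primitive f).
  replace (Ci *: (Copp Ci *: (integral (fun r => U r f) 0 T -: T *: f)))
    with ((F T -: F 0) -: T *: U 0 f).
  2:{ unfold F, orbit_primitive. rewrite !integral_point, (U_zero U hU).
      apply inner_ext. intro z.
      rewrite !inner_vscal, !inner_vsub, inner_vzero, inner_vscal.
      apply injective_projections; simpl; ring. }
  apply derivative_ext with
    (fun h => (integral F 0 (h + T) -: integral F 0 h) -: T *: F h).
  { intro h. symmetry. unfold double_integral.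
    rewrite (integral_linear _ (U_linear U hU h)) by apply orbit_primitive_continuous.
    rewrite (integral_ext _ (fun t => F (t + h) +: (Copp 1) *: F h)).
    2:{ intro t. rewrite <- vsub_eq. apply orbit_primitive_shift. }
    rewrite integral_vadd.
    - rewrite integral_shift, integral_const by apply orbit_primitive_continuous.
      rewrite <- (integral_chasles F 0 h (h + T)) by apply orbit_primitive_continuous.
      rewrite Rplus_0_l, (Rplus_comm T h), Rminus_0_r. hilbert_ring.
    - apply (derivative_continuous _ (fun t => U (t + h) f)). intro t.
      apply (derivative_shift F).
      apply (derivative_integral (fun r => U r f) 0 (t + h)), orbit_continuous, hU.
    - apply continuous_const_curve. }
  assert (DF : forall t, derivative F t (U t f)).
  { intro t. apply (derivative_integral (fun r => U r f) 0 t), orbit_continuous, hU. }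
  assert (DG : forall t, derivative (fun r => integral F 0 r) t (F t)).
  { intro t. apply derivative_integral, orbit_primitive_continuous. }
  apply derivative_vsub; [apply derivative_vsub |].
  - apply (derivative_shift (fun r => integral F 0 r)). rewrite Rplus_0_l. apply DG.
  - apply DG.
  - exact (derivative_linear (fun x => T *: x) (vscal_linear T) _ _ _ (DF 0)).
Qed.

Lemma double_integral_generator f g : generator U f g ->
  integral (fun r => U r f) 0 T -: T *: f = Ci *: double_integral g.
Proof.
  intro Bf. symmetry. unfold double_integral.
  rewrite (integral_linear (fun x => Ci *: x) (vscal_linear Ci))
    by apply orbit_primitive_continuous.
  rewrite (integral_ext _ (fun t => U t f +: Copp 1 *: f)).
  2:{ intro t. unfold orbit_primitive. rewrite (orbit_increment U hU f g 0 t Bf).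
      rewrite (U_zero U hU). apply vsub_eq. }
  rewrite integral_vadd; [| apply orbit_continuous, hU | apply continuous_const_curve].
  rewrite integral_const, Rminus_0_r. hilbert_ring.
Qed.

Lemma orbit_primitive_vadd f g t :
  orbit_primitive (f +: g) t = orbit_primitive f t +: orbit_primitive g t.
Proof.
  unfold orbit_primitive.
  rewrite (integral_ext _ (fun r => U r f +: U r g))
    by (intro r; apply (map_vadd _ (U_linear U hU r))).
  apply integral_vadd; apply orbit_continuous, hU.
Qed.

Lemma orbit_primitive_vscal a f t :
  orbit_primitive (a *: f) t = a *: orbit_primitive f t.
Proof.
  unfold orbit_primitive.
  rewrite (integral_ext _ (fun r => a *: U r f))
    by (intro r; apply (map_vscal _ (U_linear U hU r))).
  symmetry. apply (integral_linear (fun x => a *: x) (vscal_linear a)).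
  apply orbit_continuous, hU.
Qed.

Lemma double_integral_vadd f g :
  double_integral (f +: g) = double_integral f +: double_integral g.
Proof.
  unfold double_integral. rewrite <- integral_vadd by apply orbit_primitive_continuous.
  apply integral_ext. intro t. apply orbit_primitive_vadd.
Qed.

Lemma double_integral_vscal a f :
  double_integral (a *: f) = a *: double_integral f.
Proof.
  unfold double_integral.
  rewrite (integral_linear (fun x => a *: x) (vscal_linear a))
    by apply orbit_primitive_continuous.
  apply integral_ext. intro t. apply orbit_primitive_vscal.
Qed.

Lemma double_integral_vsub f g :
  double_integral (f -: g) = double_integral f -: double_integral g.
Proof.
  rewrite !vsub_eq, double_integral_vadd, double_integral_vscal. reflexivity.
Qed.

Lemma double_integral_norm f : norm (double_integral f) <= T ^ 2 * norm f.
Proof.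
  replace (T ^ 2 * norm f) with (norm f * T * (T - 0)) by ring.
  apply integral_bound; [apply orbit_primitive_continuous | lra |].
  intros t Ht. apply Rle_trans with (norm f * (t - 0)).
  - apply orbit_integral_bound; [exact hU | lra].
  - apply Rmult_le_compat_l; [apply norm_ge_0 | lra].
Qed.

Lemma projection_orbit_primitive f t : P f = vzero -> P (orbit_primitive f t) = vzero.
Proof.
  intro Z. apply (projection_integral U P hU hP); [apply orbit_continuous, hU |].
  intro r. rewrite (projection_U U P hU hP). exact Z.
Qed.

Lemma projection_double_integral f : P f = vzero -> P (double_integral f) = vzero.
Proof.
  intro Z. apply (projection_integral U P hU hP); [apply orbit_primitive_continuous |].
  intro t. apply projection_orbit_primitive, Z.
Qed.

Section SmallLambda.

Variable lambda : R.
Hypothesis lambda_small : Rabs lambda <= / (4 * T).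
Hypothesis lambda_nonzero : lambda <> 0.

Local Notation A := (ergodic_average U T 0).
Local Notation W := double_integral.

(** The operator [D] with [(B - lambda) (- i W / T) = 1 - D]. *)
Definition perturbation (x : H) : H := A x -: (Ci * (lambda / T)%R)%C *: W x.

Lemma perturbation_vsub x y :
  perturbation x -: perturbation y = perturbation (x -: y).
Proof.
  unfold perturbation. rewrite (average_vsub U hU), double_integral_vsub. hilbert_ring.
Qed.

Lemma perturbation_norm x : P x = vzero -> norm (perturbation x) <= 3 / 4 * norm x.
Proof.
  intro Z. apply Rle_trans with (1 := norm_vsub_le _ _).
  rewrite norm_vscal, Cmod_mult, Cmod_Ci, Cmod_R, Rmult_1_l.
  assert (C := close x). rewrite Z in C.
  replace (A x -: vzero) with (A x) in C by hilbert_ring.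
  assert (N := double_integral_norm x). assert (x0 := norm_ge_0 x).
  assert (iT : 0 < / T) by (apply Rinv_0_lt_compat; lra).
  assert (Q : Rabs (lambda / T) * norm (W x) <= / (4 * T) * / T * (T ^ 2 * norm x)).
  { unfold Rdiv. rewrite Rabs_mult, (Rabs_pos_eq (/ T)) by lra.
    apply Rmult_le_compat; [| apply norm_ge_0 | | exact N].
    - apply Rmult_le_pos; [apply Rabs_pos | lra].
    - apply Rmult_le_compat_r; [lra | exact lambda_small]. }
  replace (/ (4 * T) * / T * (T ^ 2 * norm x)) with (/ 4 * norm x) in Q by (field; lra).
  lra.
Qed.

Lemma projection_perturbation x : P x = vzero -> P (perturbation x) = vzero.
Proof.
  intro Z. assert (LP := projection_linear U P hU hP).
  unfold perturbation. rewrite (map_vsub _ LP), (map_vscal _ LP), projection_double_integral by exact Z.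
  rewrite ergodic_average_integral, (map_vscal _ LP).
  assert (E := projection_orbit_primitive x T Z). unfold orbit_primitive in E.
  rewrite E. hilbert_ring.
Qed.

Lemma projection_complement x : P (x -: P x) = vzero.
Proof.
  rewrite (map_vsub _ (projection_linear U P hU hP)).
  rewrite (projection_of_fixed U P hU hP (P x)) by (intro t; apply (projection_fixed U P hP)).
  hilbert_ring.
Qed.

(** The Neumann series is applied to [D (1 - P)], a contraction of the whole
    space; its solution lies in the complement because [D] preserves it. *)
Lemma solve_complement y : P y = vzero -> exists z, P z = vzero /\ z -: perturbation z = y.
Proof.
  intro Z. assert (LP := projection_linear U P hU hP).
  destruct (neumann (fun x => perturbation (x -: P x)) (3 / 4)) with (y := y) as [z Hz].
  - lra.
  - intros x x'. rewrite perturbation_vsub, (map_vsub _ LP). f_equal. hilbert_ring.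
  - intro x. apply Rle_trans with (1 := perturbation_norm _ (projection_complement x)).
    apply Rmult_le_compat_l; [lra | apply (projection_complement_norm U P hP)].
  - assert (Pz : P z = vzero).
    { assert (E := f_equal P Hz).
      rewrite (map_vsub _ LP), projection_perturbation, Z in E
        by apply projection_complement.
      rewrite <- E. hilbert_ring. }
    exists z. split; [exact Pz |].
    rewrite Pz in Hz. replace (z -: vzero) with z in Hz by hilbert_ring. exact Hz.
Qed.

Lemma generator_onto : onto (generator U) lambda.
Proof.
  intro y.
  destruct (solve_complement (y -: P y) (projection_complement y)) as [z [Pz Ez]].
  (* The solution [- i W z / T - P y / lambda] adds the inverses of [B - lambda]
     on the complement and on the fixed vectors. *)
  set (c := (Copp Ci * (/ T)%R)%C).
  set (g := c *: (Copp Ci *: (integral (fun r => U r z) 0 T -: T *: z))).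
  exists (c *: W z +: (- / lambda)%R *: P y), (g +: (- / lambda)%R *: vzero).
  split.
  - apply (generator_linear U hU); [| apply (generator_projection U P hP)].
    replace (c *: W z) with (W z +: (c - 1)%C *: W z) by hilbert_ring.
    set (d := Copp Ci *: (integral (fun r => U r z) 0 T -: T *: z)).
    replace g with (d +: (c - 1)%C *: d) by (unfold g, d; hilbert_ring).
    apply (generator_linear U hU); apply generator_double_integral.
  - replace y with ((y -: P y) +: P y) at 2 by hilbert_ring.
    rewrite <- Ez. unfold perturbation, g, c. rewrite ergodic_average_integral, Rminus_0_r.
    apply inner_ext. intro v.
    rewrite ?inner_vsub, ?inner_vadd, ?inner_vscal, ?inner_vadd, ?inner_vsub, ?inner_vscal,
      ?inner_vzero, ?inner_vsub, ?inner_vscal.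
    apply injective_projections; simpl; field; (split; [lra | exact lambda_nonzero]).
Qed.

(** For [f] orthogonal to the fixed vectors and [g = B f],
    [A f - f = (i / T) W g] turns into [f = D f - (i / T) W (g - lambda f)]. *)
Lemma generator_bounded_below : bounded_below (generator U) lambda.
Proof.
  assert (LP := projection_linear U P hU hP).
  assert (lp : 0 < / Rabs lambda) by (apply Rinv_0_lt_compat, Rabs_pos_lt, lambda_nonzero).
  exists (4 * T + / Rabs lambda). split; [lra |].
  intros f g Bf. set (y := g -: lambda *: f).
  assert (Py : P y = (- lambda)%R *: P f).
  { unfold y. rewrite (map_vsub _ LP), (map_vscal _ LP), (projection_generator U P hU hP f g Bf).
    hilbert_ring. }
  set (f' := f -: P f). assert (Zf : P f' = vzero) by apply projection_complement.
  assert (Bf' : generator U f' g).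
  { replace g with (g -: vzero) by hilbert_ring.
    apply (linear_graph_sub _ (generator_linear U hU)); [exact Bf |].
    apply (generator_projection U P hP). }
  assert (Ey : y -: P y = g -: lambda *: f').
  { rewrite Py. unfold y, f'. hilbert_ring. }
  assert (E : f' = perturbation f' -: (Ci * (/ T)%R)%C *: W (y -: P y)).
  { rewrite Ey, double_integral_vsub, double_integral_vscal.
    unfold perturbation. rewrite ergodic_average_integral, Rminus_0_r.
    transitivity ((/ T)%R *: integral (fun r => U r f') 0 T -: (/ T)%R *: (Ci *: W g)).
    - rewrite <- (double_integral_generator f' g Bf').
      apply inner_ext. intro v. rewrite !inner_vsub, !inner_vscal, inner_vsub, inner_vscal.
      apply injective_projections; simpl; field; lra.
    - apply inner_ext. intro v.
      rewrite ?inner_vsub, ?inner_vscal, ?inner_vsub, ?inner_vscal.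
      apply injective_projections; simpl; field; lra. }
  assert (iT : 0 < / T) by (apply Rinv_0_lt_compat; lra).
  assert (N1 : norm f' <= 3 / 4 * norm f' + T * norm y).
  { rewrite E at 1. apply Rle_trans with (1 := norm_vsub_le _ _).
    apply Rplus_le_compat; [apply perturbation_norm, Zf |].
    rewrite norm_vscal, Cmod_mult, Cmod_Ci, Cmod_R, Rmult_1_l, Rabs_pos_eq by lra.
    replace (T * norm y) with (/ T * (T ^ 2 * norm y)) by (field; lra).
    apply Rmult_le_compat_l; [lra |].
    apply Rle_trans with (1 := double_integral_norm _).
    apply Rmult_le_compat_l; [nra | apply (projection_complement_norm U P hP)]. }
  assert (N2 : norm (P f) <= / Rabs lambda * norm y).
  { apply (Rmult_le_reg_l (Rabs lambda)); [apply Rabs_pos_lt, lambda_nonzero |].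
    rewrite <- Rmult_assoc, Rinv_r, Rmult_1_l by apply Rabs_no_R0, lambda_nonzero.
    rewrite <- Rabs_Ropp, <- norm_vscalR, <- Py. apply (projection_norm U P hP). }
  replace f with (f' +: P f) at 1 by (unfold f'; hilbert_ring).
  apply Rle_trans with (1 := norm_vadd_le _ _). lra.
Qed.

End SmallLambda.

Lemma convergence_gap lambda :
  - / (4 * T) < lambda < / (4 * T) -> lambda <> 0 -> resolvent_set (generator U) lambda.
Proof.
  intros Hl l0. assert (Rabs lambda <= / (4 * T)) by (apply Rabs_le; lra).
  apply resolvent_of_onto.
  - exact (generator_linear U hU).
  - apply generator_bounded_below; assumption.
  - apply generator_onto; assumption.
Qed.

End ConvergenceToGap.

(** A bound on the unit ball, extended to all vectors by scaling. *)
Lemma uniform_convergence_close {H : HilbertSpace} (U : R -> H -> H) (P : H -> H) :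
  unitary_group U -> orthogonal_projection (fixed_space U) P ->
  uniform_ergodic_convergence U P ->
  exists T, 0 < T /\ forall f : H,
    norm (ergodic_average U T 0 f -: P f) <= / 2 * norm f.
Proof.
  intros hU hP Conv. destruct (Conv (/ 2)) as [T0 HT]; [lra |].
  set (T := Rmax T0 0 + 1).
  assert (M1 := Rmax_l T0 0). assert (M2 := Rmax_r T0 0).
  exists T. split; [unfold T; lra |]. intro f.
  assert (T1 : 0 < T) by (unfold T; lra). assert (T2 : T0 < T - 0) by (unfold T; lra).
  assert (L := HT T 0 T1 T2).
  assert (Unit : forall x, norm x <= 1 -> norm (ergodic_average U T 0 x -: P x) <= / 2).
  { intros x Nx.
    assert (A : Rbar_lt (norm (ergodic_average U T 0 x -: P x)) (/ 2)).
    { apply Rbar_le_lt_trans with (2 := L). apply (proj1 (Lub_Rbar_correct _)).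
      exists x. split; [exact Nx | reflexivity]. }
    apply Rlt_le, A. }
  destruct (Rle_lt_or_eq_dec _ _ (norm_ge_0 f)) as [f0 | f0].
  - assert (i0 : 0 < / norm f) by (apply Rinv_0_lt_compat, f0).
    assert (A : norm (ergodic_average U T 0 ((/ norm f)%R *: f) -: P ((/ norm f)%R *: f)) <= / 2).
    { apply Unit. rewrite norm_vscalR, Rabs_pos_eq, Rinv_l; lra. }
    rewrite (average_vscal U hU), (map_vscal _ (projection_linear U P hU hP)) in A.
    set (a := ergodic_average U T 0 f) in *.
    replace ((/ norm f)%R *: a -: (/ norm f)%R *: P f)
      with ((/ norm f)%R *: (a -: P f)) in A by hilbert_ring.
    rewrite norm_vscalR, Rabs_pos_eq in A by lra.
    apply (Rmult_le_reg_l (/ norm f)); [exact i0 |].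
    replace (/ norm f * (/ 2 * norm f)) with (/ 2) by (field; lra). exact A.
  - apply Rle_trans with (1 := norm_vsub_le _ _).
    assert (A := average_norm U hU T 0 f T1). assert (A' := projection_norm U P hP f). lra.
Qed.

Theorem mainTheorem7 (H : HilbertSpace) (U : R -> H -> H) (P : H -> H)
    (hU : unitary_group U)
    (hP : orthogonal_projection (fixed_space U) P) :
  uniform_ergodic_convergence U P <->
  exists gamma : R, 0 < gamma /\
    forall lambda : R, - gamma < lambda < gamma -> lambda <> 0 ->
      ~ spectrum (generator U) (RtoC lambda).
Proof.
  split.
  - intro Conv.
    destruct (uniform_convergence_close U P hU hP Conv) as [T [T0 HT]].
    exists (/ (4 * T)). split; [apply Rinv_0_lt_compat; lra |].
    intros lambda Hl l0 Sp. apply Sp.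
    exact (convergence_gap U P T hU hP T0 HT lambda Hl l0).
  - intros [gamma [g0 Hg]]. apply (gap_uniform_convergence U P gamma hU hP g0).
    intros lambda Hl l0. exact (NNPP _ (Hg lambda Hl l0)).
Qed.
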